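(* Given a graph $G$ along with a decomposition tree of $G$ of rank-width $\mathsf{rw}$, the \textsc{Maximum Odd Subgraph} problem can be solved in time $\mathcal{O}^*(2^{3\,\mathsf{rw}})$.
   Context: All graphs are finite, simple and undirected. A graph is called odd if every vertex has odd degree. The \textsc{Maximum Odd Subgraph} problem is: given a graph $G$, determine the maximum number of vertices of an odd induced subgraph of $G$. A decomposition tree of $G$ is a pair $(T,\delta)$ where $T$ is a full binary tree (rooted, every non-leaf node has two children) and $\delta$ is a bijection between the leaves of $T$ and $V(G)$. For a node $w$ of $T$, let $V_w\subseteq V(G)$ be the set of vertices corresponding via $\delta$ to the leaves of the subtree rooted at $w$, and $\overline{V_w}=V(G)\setminus V_w$. The rank-width of $(T,\delta)$ is the maximum over all nodes $w$ of $T$ of the rank over $\mathrm{GF}(2)$ of the $V_w\times\overline{V_w}$ adjacency matrix of the bipartite graph $G[V_w,\overline{V_w}]$ (edges of $G$ between $V_w$ and $\overline{V_w}$). The notation $\mathcal{O}^*$ hides factors polynomial in the input size. *)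

(* Defs.v *)
From mathcomp Require Import all_boot all_order all_algebra.

Set Implicit Arguments.
Unset Strict Implicit.
Unset Printing Implicit Defensive.

Record sgraph := SGraph {
  vertex :> finType;
  adj : rel vertex;
  adj_sym : symmetric adj;
  adj_irrefl : irreflexive adj
}.

Definition degree (G : sgraph) (v : G) : nat := #|[set u : G | adj v u]|.

Definition odd_graph (G : sgraph) : bool := [forall v : G, odd (degree v)].

Section Induced.
Variables (G : sgraph) (S : {set G}).

Definition induced_adj : rel {v : G | v \in S} :=
  fun u v => adj (val u) (val v).

Lemma induced_sym : symmetric induced_adj.
Proof. by move=> u v; apply: adj_sym. Qed.

Lemma induced_irrefl : irreflexive induced_adj.
Proof. by move=> u; apply: adj_irrefl. Qed.

Definition induced : sgraph := SGraph induced_sym induced_irrefl.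
End Induced.

(* The graph with no vertex is odd, so this is a maximum over a nonempty
   family. *)
Definition max_odd (G : sgraph) : nat :=
  \max_(S : {set G} | odd_graph (induced S)) #|S|.

(* A full binary tree whose leaves carry their image under delta; a node is
   identified with the subtree rooted at it. *)
Inductive dtree (V : Type) : Type :=
| Leaf of V
| Node of dtree V & dtree V.

Fixpoint leaves (V : Type) (t : dtree V) : seq V :=
  match t with
  | Leaf v => [:: v]
  | Node l r => leaves l ++ leaves r
  end.

Fixpoint nodes (V : Type) (t : dtree V) : seq (dtree V) :=
  t :: match t with
       | Leaf _ => [::]
       | Node l r => nodes l ++ nodes r
       end.

(* delta is a bijection: every vertex labels exactly one leaf. *)
Definition is_decomposition (G : sgraph) (t : dtree G) : Prop :=
  uniq (leaves t) /\ forall v : G, v \in leaves t.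

Definition cut_matrix (G : sgraph) (A : {set G}) :
    'M['F_2]_(#|A|, #|~: A|) :=
  (\matrix_(i < #|A|, j < #|~: A|) (adj (enum_val i) (enum_val j))%:R)%R.

Definition rank_width (G : sgraph) (t : dtree G) : nat :=
  \max_(w <- nodes t) \rank (cut_matrix [set v in leaves w]).

(* A first-order functional language over cons cells.  A program is a finite
   list of mutually recursive one-argument functions; time is the number of
   expression nodes evaluated.  For a fixed program each step is a bounded
   number of pointer operations on a RAM (values are immutable and shared,
   and there is no structural equality test), and conversely t steps of a RAM
   on O(log t)-bit words are simulated with an overhead polynomial in log t.
   Hence bounds of the form 2^(c * rw) * poly(input size), c included, do not
   depend on which of the two models is used. *)

Inductive value : Type :=
| Nil
| Cons of value & value.

(* Variables are de Bruijn indices.  [ECase e e0 e1] evaluates [e0] if [e] is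
   [Nil]; if [e] is [Cons a b] it evaluates [e1] with [a] as variable 0 and
   [b] as variable 1. *)
Inductive expr : Type :=
| EVar of nat
| ENil
| ECons of expr & expr
| ECase of expr & expr & expr
| ELet of expr & expr
| ECall of nat & expr.

Definition program : Type := seq expr.

(* [eval p env e v t]: under [env], [e] evaluates to [v] in time [t]. *)
Inductive eval (p : program) : seq value -> expr -> value -> nat -> Prop :=
| eval_var env i :
    eval p env (EVar i) (nth Nil env i) 1
| eval_nil env :
    eval p env ENil Nil 1
| eval_cons env e1 e2 v1 v2 t1 t2 :
    eval p env e1 v1 t1 -> eval p env e2 v2 t2 ->
    eval p env (ECons e1 e2) (Cons v1 v2) (t1 + t2).+1
| eval_case_nil env e e0 e1 v t t0 :
    eval p env e Nil t -> eval p env e0 v t0 ->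
    eval p env (ECase e e0 e1) v (t + t0).+1
| eval_case_cons env e e0 e1 a b v t t1 :
    eval p env e (Cons a b) t -> eval p (a :: b :: env) e1 v t1 ->
    eval p env (ECase e e0 e1) v (t + t1).+1
| eval_let env e1 e2 v1 v t1 t2 :
    eval p env e1 v1 t1 -> eval p (v1 :: env) e2 v t2 ->
    eval p env (ELet e1 e2) v (t1 + t2).+1
| eval_call env f e a v t t' :
    eval p env e a t -> eval p [:: a] (nth ENil p f) v t' ->
    eval p env (ECall f e) v (t + t').+1.

Lemma eval_det (p : program) env e v t v' t' :
  eval p env e v t -> eval p env e v' t' -> v = v' /\ t = t'.
Proof.
move=> H; elim: H v' t' => {env e v t};
  (intros; match goal with H : eval _ _ _ _ _ |- _ => inversion H; subst end);
  repeat match goal with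
  | IH : (forall v' t', eval ?p ?env ?e v' t' -> _), H : eval ?p ?env ?e _ _
      |- _ =>
    let Ev := fresh in let Et := fresh in
    case: (IH _ _ H) => Ev Et; clear IH H; try discriminate Ev;
    try (injection Ev; intros); subst
  end; by [].
Qed.

(* The entry point is function 0. *)
Definition computes_within (p : program) (input output : value)
    (bound : nat) : Prop :=
  exists2 t, eval p [:: input] (nth ENil p 0) output t & t <= bound.

Fixpoint value_size (v : value) : nat :=
  match v with
  | Nil => 1
  | Cons a b => (value_size a + value_size b).+1
  end.

(* Unary: the only numbers encoded are bounded by the number of vertices. *)
Definition enc_nat (n : nat) : value := iter n (Cons Nil) Nil.

Definition enc_bool (b : bool) : value := enc_nat b.

Definition enc_seq (s : seq value) : value := foldr Cons Nil s.

(* The adjacency matrix, in the order of [enum G]. *)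
Definition enc_graph (G : sgraph) : value :=
  enc_seq [seq enc_seq [seq enc_bool (adj u v) | v <- enum G] | u <- enum G].

Fixpoint enc_dtree (V : finType) (t : dtree V) : value :=
  match t with
  | Leaf v => Cons (enc_bool false) (enc_nat (enum_rank v))
  | Node l r => Cons (enc_bool true) (Cons (enc_dtree l) (enc_dtree r))
  end.

Definition enc_instance (G : sgraph) (t : dtree G) : value :=
  Cons (enc_graph G) (enc_dtree t).

(* Main.v *)
(* Dynamic programming over the decomposition tree.  Write par S v for the
   parity of the number of neighbours of v in S.  For a node w, a set
   S \subset V_w interacts with the rest of the graph only through par S
   outside V_w, and the rest interacts with S only through a parity vector on
   V_w; the former vectors form the row space of the cut matrix, the latter its
   column space, so there are at most 2^rw of each.  Since they have disjoint
   supports, a pair of them is a single vector z, and the table of w maps z to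
   the largest size of a set S with par S = z outside V_w and par S <> z on S.
   Tables are joined over the triples formed by an outer vector of w and an
   inner vector of each child.  Lookup in a binary trie takes time polynomial
   in the number of vertices, hence the bound 2^(3 rw). *)

Require Import Defs.
From mathcomp Require Import all_boot all_order all_algebra.
From mathcomp Require Import zify.

(* [seq] also has notations [Nil] and [Cons]; this restores the constructors
   of [value]. *)
Import Defs.

Set Implicit Arguments.
Unset Strict Implicit.
Unset Printing Implicit Defensive.

(** * The program *)

(* Programs are written with Rocq binders: a [term] awaits the number of
   variables in scope, and a variable is its binding level, converted to a
   de Bruijn index where it is used. *)
Definition term := nat -> expr.
Definition tvar l : term := fun d => EVar (d - l.+1).
Definition tnil : term := fun=> ENil.
Definition tcons (e1 e2 : term) : term := fun d => ECons (e1 d) (e2 d).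
Definition tcase (e e0 : term) (f : term -> term -> term) : term :=
  fun d => ECase (e d) (e0 d) (f (tvar d.+1) (tvar d) d.+2).
Definition tlet (e : term) (f : term -> term) : term :=
  fun d => ELet (e d) (f (tvar d) d.+1).
Definition tcall (g : nat) (e : term) : term := fun d => ECall g (e d).
Definition fn (f : term -> term) : expr := f (tvar 0) 1.

Definition tsplit (e : term) (f : term -> term -> term) : term :=
  tcase e tnil f.
Definition ttrue : term := tcons tnil tnil.

Declare Scope term_scope.
Delimit Scope term_scope with T.
Bind Scope term_scope with term.
Notation "x ;; y" := (tcons x%T y%T)
  (at level 60, right associativity) : term_scope.
Notation "'unpair' e 'as' ( x , y ) 'in' f" := (tsplit e%T (fun x y => f%T))
  (at level 200, e at level 100, x name, y name, f at level 200) : term_scope.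
Notation "'caseof' e 'of_nil' e0 'of_cons' ( x , y ) e1" :=
  (tcase e%T e0%T (fun x y => e1%T))
  (at level 200, e at level 100, e0 at level 100, x name, y name,
   e1 at level 200) : term_scope.
Notation "'bind' x := e 'in' f" := (tlet e%T (fun x => f%T))
  (at level 200, x name, e at level 100, f at level 200) : term_scope.

(** These numbers are positions in [prog] and must agree with its order; position 0 is the entry
    point. *)
Notation f_xor := 1 (only parsing).
Notation f_sel := 2 (only parsing).
Notation f_neg := 3 (only parsing).
Notation f_eq := 4 (only parsing).
Notation f_mem := 5 (only parsing).
Notation f_mapxor := 6 (only parsing).
Notation f_extend := 7 (only parsing).
Notation f_span := 8 (only parsing).
Notation f_unit := 9 (only parsing).
Notation f_nth := 10 (only parsing).
Notation f_lookup := 11 (only parsing).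
Notation f_insert := 12 (only parsing).
Notation f_max := 13 (only parsing).
Notation f_add := 14 (only parsing).
Notation f_comb := 15 (only parsing).
Notation f_step := 16 (only parsing).
Notation f_loop3 := 17 (only parsing).
Notation f_loop2 := 18 (only parsing).
Notation f_loop1 := 19 (only parsing).
Notation f_solve := 20 (only parsing).

(** The xor of [m] with itself is the zero vector of the right length, a device used throughout.
    Nothing lies outside the root, so the answer sits at the zero key; entries are sizes plus one,
    and the outer [unpair] strips the successor. *)
Definition e_main := fn (fun a =>
  unpair a as (g, t) in
  unpair (tcall f_solve (t ;; g)) as (m, tab) in
  unpair (tcall f_lookup (tab ;; tcall f_xor (m ;; m))) as (u, k) in k)%T.

Definition e_xor := fn (fun a =>
  unpair a as (x, y) in
  caseof x of_nil tnil of_cons (b, x')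
  caseof y of_nil tnil of_cons (c, y')
  (caseof b of_nil c of_cons (u, u') caseof c of_nil ttrue of_cons (w, w') tnil)
    ;; tcall f_xor (x' ;; y'))%T.

Definition e_sel := fn (fun a =>
  unpair a as (m, a') in
  unpair a' as (x, y) in
  caseof m of_nil tnil of_cons (b, m')
  caseof x of_nil tnil of_cons (c, x')
  caseof y of_nil tnil of_cons (d, y')
  (caseof b of_nil d of_cons (u, u') c) ;; tcall f_sel (m' ;; x' ;; y'))%T.

Definition e_neg := fn (fun x =>
  caseof x of_nil tnil of_cons (b, x')
  (caseof b of_nil ttrue of_cons (u, u') tnil) ;; tcall f_neg x')%T.

Definition e_eq := fn (fun a =>
  unpair a as (x, y) in
  caseof x of_nil (caseof y of_nil ttrue of_cons (u, u') tnil) of_cons (b, x')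
  caseof y of_nil tnil of_cons (c, y')
  caseof b of_nil (caseof c of_nil tcall f_eq (x' ;; y') of_cons (u, u') tnil)
         of_cons (w, w')
  caseof c of_nil tnil of_cons (u, u') tcall f_eq (x' ;; y'))%T.

Definition e_mem := fn (fun a =>
  unpair a as (x, L) in
  caseof L of_nil tnil of_cons (l, L')
  caseof tcall f_eq (x ;; l) of_nil tcall f_mem (x ;; L') of_cons (u, u')
  ttrue)%T.

Definition e_mapxor := fn (fun a =>
  unpair a as (x, a') in
  unpair a' as (L, acc) in
  caseof L of_nil acc of_cons (l, L')
  tcall f_xor (x ;; l) ;; tcall f_mapxor (x ;; L' ;; acc))%T.

(* On a list closed under addition, this adjoins a generator without creating
   duplicates. *)
Definition e_extend := fn (fun a =>
  unpair a as (x, L) in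
  caseof tcall f_mem (x ;; L) of_nil tcall f_mapxor (x ;; L ;; L)
                            of_cons (u, u') L)%T.

(* The span of the rows selected by [ms], restricted to the complement of
   [m]. *)
Definition e_span := fn (fun a =>
  unpair a as (m, a') in
  unpair a' as (ms, rows) in
  caseof ms of_nil (tcall f_xor (m ;; m) ;; tnil) of_cons (b, ms')
  caseof rows of_nil (tcall f_xor (m ;; m) ;; tnil) of_cons (row, rows')
  bind L := tcall f_span (m ;; ms' ;; rows') in
  caseof b of_nil L of_cons (u, u')
  tcall f_extend (tcall f_sel (m ;; tcall f_xor (m ;; m) ;; row) ;; L))%T.

Definition e_unit := fn (fun a =>
  unpair a as (i, x) in
  caseof x of_nil tnil of_cons (b, x')
  caseof i of_nil (ttrue ;; tcall f_xor (x' ;; x')) of_cons (u, i')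
  tnil ;; tcall f_unit (i' ;; x'))%T.

Definition e_nth := fn (fun a =>
  unpair a as (i, L) in
  caseof L of_nil tnil of_cons (l, L')
  caseof i of_nil l of_cons (u, i') tcall f_nth (i' ;; L'))%T.

(* A table is a binary trie: [Nil] is the empty trie and, past the last bit of
   the key, the trie is the stored number in unary, 0 meaning no entry. *)
Definition e_lookup := fn (fun a =>
  unpair a as (t, z) in
  caseof z of_nil t of_cons (b, z')
  caseof t of_nil tnil of_cons (t0, t1)
  tcall f_lookup ((caseof b of_nil t0 of_cons (u, u') t1) ;; z'))%T.

Definition e_insert := fn (fun a =>
  unpair a as (t, a') in
  unpair a' as (z, v) in
  caseof z of_nil tcall f_max (t ;; v) of_cons (b, z')
  caseof t
    of_nil (caseof b of_nil (tcall f_insert (tnil ;; z' ;; v) ;; tnil)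
                   of_cons (u, u') tnil ;; tcall f_insert (tnil ;; z' ;; v))
    of_cons (t0, t1)
  caseof b of_nil (tcall f_insert (t0 ;; z' ;; v) ;; t1)
         of_cons (u, u') t0 ;; tcall f_insert (t1 ;; z' ;; v))%T.

Definition e_max := fn (fun a =>
  unpair a as (x, y) in
  caseof x of_nil y of_cons (u, x')
  caseof y of_nil x of_cons (u', y')
  tnil ;; tcall f_max (x' ;; y'))%T.

Definition e_add := fn (fun a =>
  unpair a as (x, y) in
  caseof x of_nil y of_cons (u, x') tnil ;; tcall f_add (x' ;; y))%T.

(* Entries are sizes plus one, so that adding two nonzero entries drops a
   successor. *)
Definition e_comb := fn (fun a =>
  unpair a as (x, y) in
  caseof x of_nil tnil of_cons (u, x')
  caseof y of_nil tnil of_cons (u', y') tcall f_add (x' ;; y))%T.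

(* With [c] supported on V_w and [ra], [rb] supported off the two children,
   [s] is at once the vector imposed from outside on each child and the
   adjacency parity of the union outside V_w. *)
Definition e_step := fn (fun a =>
  unpair a as (k, a1) in unpair a1 as (t, a2) in
  unpair a2 as (c, a3) in unpair a3 as (ra, rb) in
  unpair k as (m, k1) in unpair k1 as (ma, k2) in unpair k2 as (ta, k3) in
  unpair k3 as (mb, tb) in
  bind s := tcall f_xor (c ;; tcall f_xor (ra ;; rb)) in
  tcall f_insert (t ;; tcall f_sel (m ;; c ;; s) ;;
    tcall f_comb (tcall f_lookup (ta ;; tcall f_sel (ma ;; s ;; ra)) ;;
                  tcall f_lookup (tb ;; tcall f_sel (mb ;; s ;; rb)))))%T.

(* Since [c], [ra] and [rb] range over lists of size at most 2^rw, the step is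
   run at most 2^(3 rw) times. *)
Definition e_loop3 := fn (fun a =>
  unpair a as (k, a1) in unpair a1 as (t, a2) in
  unpair a2 as (c, a3) in unpair a3 as (ra, Rb) in
  caseof Rb of_nil t of_cons (rb, Rb')
  tcall f_step (k ;; tcall f_loop3 (k ;; t ;; c ;; ra ;; Rb') ;;
                c ;; ra ;; rb))%T.

Definition e_loop2 := fn (fun a =>
  unpair a as (k, a1) in unpair a1 as (t, a2) in
  unpair a2 as (c, a3) in unpair a3 as (Ra, Rb) in
  caseof Ra of_nil t of_cons (ra, Ra')
  tcall f_loop3 (k ;; tcall f_loop2 (k ;; t ;; c ;; Ra' ;; Rb) ;;
                 c ;; ra ;; Rb))%T.

Definition e_loop1 := fn (fun a =>
  unpair a as (k, a1) in unpair a1 as (C, a2) in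
  unpair a2 as (Ra, Rb) in
  caseof C of_nil tnil of_cons (c, C')
  tcall f_loop2 (k ;; tcall f_loop1 (k ;; C' ;; Ra ;; Rb) ;;
                 c ;; Ra ;; Rb))%T.

(** At a leaf [v], [row0] only supplies the vector length. The empty set, stored as 1, goes to the
    two keys that vanish off [v]. The singleton of [v], stored as 2, goes to the key that is the row
    of [v] with bit [v] set, since the singleton has parity 0 at [v]. At an inner node, the span
    over [m'] lists what the outside can impose on V_w, and the other two list what each child can
    impose on its outside. *)
Definition e_solve := fn (fun a =>
  unpair a as (t, g) in unpair t as (tag, t') in
  caseof tag
    of_nil (
      unpair g as (row0, g') in
      bind e := tcall f_unit (t' ;; row0) in
      e ;; tcall f_insert
        (tcall f_insert
          (tcall f_insert (tnil ;; tcall f_xor (e ;; e) ;; ttrue) ;;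
           e ;; ttrue) ;;
         tcall f_xor (e ;; tcall f_nth (t' ;; g)) ;; tnil ;; ttrue))
    of_cons (u, u')
  unpair t' as (l, r) in
  unpair (tcall f_solve (l ;; g)) as (ma, ta) in
  unpair (tcall f_solve (r ;; g)) as (mb, tb) in
  bind m := tcall f_xor (ma ;; mb) in
  bind m' := tcall f_neg m in
  m ;; tcall f_loop1 ((m ;; ma ;; ta ;; mb ;; tb) ;;
                      tcall f_span (m' ;; m' ;; g) ;;
                      tcall f_span (ma ;; ma ;; g) ;;
                      tcall f_span (mb ;; mb ;; g)))%T.

Definition prog : program :=
  [:: e_main; e_xor; e_sel; e_neg; e_eq; e_mem; e_mapxor; e_extend; e_span;
      e_unit; e_nth; e_lookup; e_insert; e_max; e_add; e_comb; e_step;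
      e_loop3; e_loop2; e_loop1; e_solve].

(** * Running time *)

(** Times are relaxed to upper bounds, so that slack is absorbed once per function by
    [runs_conv]. *)
Definition runs env e v (T : nat) := exists2 t, eval prog env e v t & t <= T.
Definition computes f a v T := runs [:: a] (nth ENil prog f) v T.

Lemma runs_conv env e v v' T T' :
  runs env e v' T' -> v' = v -> T' <= T -> runs env e v T.
Proof.
by move=> [t He le_t] <- le_T; exists t => //; apply: leq_trans le_T.
Qed.

Lemma runs_var env i v : nth Nil env i = v -> runs env (EVar i) v 1.
Proof. by move=> <-; exists 1 => //; constructor. Qed.

Lemma runs_nil env : runs env ENil Nil 1.
Proof. by exists 1 => //; constructor. Qed.

Lemma runs_cons env e1 e2 v1 v2 T1 T2 :
  runs env e1 v1 T1 -> runs env e2 v2 T2 ->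
  runs env (ECons e1 e2) (Cons v1 v2) (T1 + T2).+1.
Proof.
move=> [t1 H1 le1] [t2 H2 le2]; exists (t1 + t2).+1; first by constructor.
by rewrite ltnS leq_add.
Qed.

(** Both evaluation rules are merged: once the head constructor of [w] is known, the [match] reduces
    to one premise and symbolic execution stays directed by the syntax. *)
Lemma runs_case env e e0 e1 w v T T' :
  runs env e w T ->
  match w with
  | Nil => runs env e0 v T'
  | Cons a b => runs (a :: b :: env) e1 v T'
  end -> runs env (ECase e e0 e1) v (T + T').+1.
Proof.
case: w => [|a b] [t He le_t] [t' Hb le_t']; exists (t + t').+1;
  by [econstructor; eauto | rewrite ltnS leq_add].
Qed.

Lemma runs_let env e1 e2 w v T T' :
  runs env e1 w T -> runs (w :: env) e2 v T' ->
  runs env (ELet e1 e2) v (T + T').+1.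
Proof.
move=> [t He le_t] [t' Hb le_t']; exists (t + t').+1;
  by [econstructor; eauto | rewrite ltnS leq_add].
Qed.

Lemma runs_call env f e a v T T' :
  runs env e a T -> computes f a v T' ->
  runs env (ECall f e) v (T + T').+1.
Proof.
move=> [t He le_t] [t' Hb le_t']; exists (t + t').+1;
  by [econstructor; eauto | rewrite ltnS leq_add].
Qed.

(** * Encodings and running times of the auxiliary functions *)

Definition vbool (b : bool) : value := if b then Cons Nil Nil else Nil.

Fixpoint vlist T (enc : T -> value) (s : seq T) : value :=
  if s is x :: s' then Cons (enc x) (vlist enc s') else Nil.

Notation bits := (vlist vbool).
Notation bitss := (vlist bits).


Create HintDb run.

Ltac simpl_enc :=
  cbn [vlist vbool enc_nat iter enc_dtree enc_bool nat_of_bool].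
Ltac run_expr :=
  lazymatch goal with
  | |- runs _ (EVar _) _ _ => apply: runs_var; cbn [nth]; reflexivity
  | |- runs _ ENil _ _ => apply: runs_nil
  | |- runs _ (ECons _ _) _ _ => eapply runs_cons; run_expr
  | |- runs _ (ECase _ _ _) _ _ =>
      eapply runs_case; [run_expr | simpl_enc; run_expr]
  | |- runs _ (ELet _ _) _ _ => eapply runs_let; run_expr
  | |- runs _ (ECall _ _) _ _ => eapply runs_call; run_expr
  | |- computes _ _ _ _ => solve [eauto 3 with run nocore]
  end.
(** Symbolic execution of a function body. Calls are closed by induction hypotheses or by the
    database [run]; what remains is the equality of the results and the inequality between the
    times. *)
Ltac run :=
  simpl_enc;
  lazymatch goal with
  | |- computes ?f ?a ?v ?T =>
      let b := eval vm_compute in (nth ENil prog f) in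
      change (runs [:: a] b v T); eapply runs_conv; [run_expr | |]
  end.

Fixpoint lxor (x y : seq bool) : seq bool :=
  match x, y with
  | b :: x', c :: y' => b (+) c :: lxor x' y'
  | _, _ => [::]
  end.

Lemma xor_run x y :
  computes f_xor (Cons (bits x) (bits y)) (bits (lxor x y)) (20 * (size x).+1).
Proof.
elim: x y => [|b x IH] [|c y]; last (case: b; case: c);
  by (run; [ | rewrite /=; lia]).
Qed.
#[local] Hint Resolve xor_run : run.

Lemma size_lxor x y : size y = size x -> size (lxor x y) = size x.
Proof. by elim: x y => [|b x IH] [|c y] //= [/IH ->]. Qed.

Fixpoint lsel (m x y : seq bool) : seq bool :=
  match m, x, y with
  | b :: m', c :: x', d :: y' => (if b then c else d) :: lsel m' x' y'
  | _, _, _ => [::]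
  end.

Lemma sel_run m x y :
  computes f_sel (Cons (bits m) (Cons (bits x) (bits y))) (bits (lsel m x y))
    (20 * (size m).+1).
Proof.
elim: m x y => [|b m IH] [|c x] [|d y]; try case: b;
  by (run; [ | rewrite /=; lia]).
Qed.
#[local] Hint Resolve sel_run : run.

Lemma size_lsel m x y :
  size x = size m -> size y = size m -> size (lsel m x y) = size m.
Proof. by elim: m x y => [|b m IH] [|c x] [|d y] //= [/IH H] [/H ->]. Qed.

Lemma neg_run x :
  computes f_neg (bits x) (bits (map negb x)) (20 * (size x).+1).
Proof.
elim: x => [|b x IH]; try case: b; by (run; [ | rewrite /=; lia]).
Qed.
#[local] Hint Resolve neg_run : run.

Lemma eq_run (x y : seq bool) :
  computes f_eq (Cons (bits x) (bits y)) (vbool (x == y)) (20 * (size x).+1).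
Proof.
elim: x y => [|b x IH] [|c y]; last (case: b; case: c);
  by (run; [ | rewrite /=; lia]).
Qed.
#[local] Hint Resolve eq_run : run.

Lemma mem_run (x : seq bool) L :
  computes f_mem (Cons (bits x) (bitss L)) (vbool (x \in L))
    (40 * (size x).+1 * (size L).+1).
Proof.
elim: L => [|l L IH]; first by run; [ | rewrite /=; lia].
have := eq_run x l; rewrite in_cons; case: (x == l) => xl;
  by (run; [ | rewrite /=; nia]).
Qed.
#[local] Hint Resolve mem_run : run.

Lemma mapxor_run (x : seq bool) L L' :
  computes f_mapxor (Cons (bits x) (Cons (bitss L) (bitss L')))
    (bitss (map (lxor x) L ++ L')) (50 * (size x).+1 * (size L).+1).
Proof.
elim: L => [|l L IH]; by (run; [ | rewrite /=; nia]).
Qed.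
#[local] Hint Resolve mapxor_run : run.

Definition extend (x : seq bool) L :=
  if x \in L then L else map (lxor x) L ++ L.

Lemma extend_run (x : seq bool) L :
  computes f_extend (Cons (bits x) (bitss L)) (bitss (extend x L))
    (130 * (size x).+1 * (size L).+1).
Proof.
rewrite /extend; have := mem_run x L; case: (x \in L) => xL;
  by (run; [ | rewrite /=; nia]).
Qed.
#[local] Hint Resolve extend_run : run.

Fixpoint span (m ms : seq bool) (rows : seq (seq bool)) : seq (seq bool) :=
  match ms, rows with
  | b :: ms', row :: rows' =>
      let L := span m ms' rows' in
      if b then extend (lsel m (lxor m m) row) L else L
  | _, _ => [:: lxor m m]
  end.

Lemma leq_size_extend (x : seq bool) L : size L <= size (extend x L).
Proof. by rewrite /extend; case: ifP; rewrite // size_cat leq_addl. Qed.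

Definition span_time m rows :=
  computes f_span (Cons (bits m) (Cons (bits m) (bitss rows)))
    (bitss (span m m rows))
    (300 * (size m).+1 * (size m).+1 * (size (span m m rows)).+1).

(** The list only grows along the recursion ([leq_size_extend]), so each extension can be charged to
    the length of the final list. *)
Lemma span_run m ms rows :
  {in rows, forall row, size row = size m} ->
  computes f_span (Cons (bits m) (Cons (bits ms) (bitss rows)))
    (bitss (span m ms rows))
    (300 * (size m).+1 * (size ms).+1 * (size (span m ms rows)).+1).
Proof.
elim: ms rows => [|b ms IH] [|row rows] szm; try by run; [ | rewrite /=; nia].
have /IH{}IH : {in rows, forall row, size row = size m}.
  by move=> r rR; apply: szm; rewrite in_cons rR orbT.
case: b; run => //=; first last.
  set s := size (span _ _ _); nia.
have -> : size (lsel m (lxor m m) row) = size m.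
  by rewrite size_lsel ?size_lxor ?szm ?mem_head.
have := leq_size_extend (lsel m (lxor m m) row) (span m ms rows).
set s := size (span _ _ _); set s' := size (extend _ _) => le_s.
have le1 : (size m).+1 * s.+1 <= (size m).+1 * s'.+1 by rewrite leq_mul2l.
have := leq_mul2l (size ms).+1 ((size m).+1 * s.+1) ((size m).+1 * s'.+1).
rewrite le1 => /= le2; nia.
Qed.
#[local] Hint Resolve span_run : run.

Fixpoint lunit (i : nat) (x : seq bool) : seq bool :=
  if x is b :: x' then
    if i is i'.+1 then false :: lunit i' x' else true :: lxor x' x'
  else [::].

Lemma leq_size_lxor x y : size (lxor x y) <= size x.
Proof. by elim: x y => [|b x IH] [|c y] //=; apply: IH. Qed.

Lemma size_lunit i x : size (lunit i x) = size x.
Proof. by elim: x i => [|b x IH] [|i] //=; rewrite ?IH ?size_lxor. Qed.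

Lemma unit_run i x :
  computes f_unit (Cons (enc_nat i) (bits x)) (bits (lunit i x))
    (50 * (size x).+1).
Proof.
elim: x i => [|b x IH] [|i]; by (run; [ | rewrite /=; nia]).
Qed.
#[local] Hint Resolve unit_run : run.

Lemma nth_run i (L : seq (seq bool)) :
  computes f_nth (Cons (enc_nat i) (bitss L)) (bits (nth [::] L i))
    (20 * (size L).+1).
Proof.
elim: L i => [|l L IH] [|i]; by (run; [ | rewrite /=; nia]).
Qed.
#[local] Hint Resolve nth_run : run.

Fixpoint lookup (t : value) (z : seq bool) {struct z} : value :=
  if z is b :: z' then
    if t is Cons t0 t1 then lookup (if b then t1 else t0) z' else Nil
  else t.

Lemma lookup_run t z :
  computes f_lookup (Cons t (bits z)) (lookup t z) (30 * (size z).+1).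
Proof.
elim: z t => [|b z IH] [|t0 t1]; try case: b; by (run; [ | rewrite /=; nia]).
Qed.
#[local] Hint Resolve lookup_run : run.

Fixpoint vmax (x y : value) : value :=
  match x, y with
  | Nil, _ => y
  | _, Nil => x
  | Cons _ x', Cons _ y' => Cons Nil (vmax x' y')
  end.

Fixpoint vlen (x : value) : nat := if x is Cons _ x' then (vlen x').+1 else 0.

Lemma max_run x y :
  computes f_max (Cons x y) (vmax x y) (20 * (vlen y).+1).
Proof.
elim: x y => [|u _ x IH] [|w y]; by (run; [ | rewrite /=; nia]).
Qed.
#[local] Hint Resolve max_run : run.

Fixpoint insert (t : value) (z : seq bool) (v : value) : value :=
  if z is b :: z' then
    match t with
    | Nil =>
        if b then Cons Nil (insert Nil z' v) else Cons (insert Nil z' v) Nil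
    | Cons t0 t1 =>
        if b then Cons t0 (insert t1 z' v) else Cons (insert t0 z' v) t1
    end
  else vmax t v.

Lemma insert_run t z v :
  computes f_insert (Cons t (Cons (bits z) v)) (insert t z v)
    (30 * (size z).+1 + 20 * (vlen v).+1).
Proof.
elim: z t => [|b z IH] [|t0 t1]; try case: b; by (run; [ | rewrite /=; nia]).
Qed.
#[local] Hint Resolve insert_run : run.

Fixpoint vadd (x y : value) : value :=
  if x is Cons _ x' then Cons Nil (vadd x' y) else y.

Lemma add_run x y :
  computes f_add (Cons x y) (vadd x y) (20 * (vlen x).+1).
Proof.
elim: x => [|u _ x IH]; by (run; [ | rewrite /=; nia]).
Qed.
#[local] Hint Resolve add_run : run.

Definition vcomb (x y : value) : value :=
  match x, y with
  | Cons _ x', Cons _ _ => vadd x' y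
  | _, _ => Nil
  end.

Lemma comb_run x y :
  computes f_comb (Cons x y) (vcomb x y) (30 * (vlen x).+1).
Proof.
case: x y => [|u x] [|w y]; by (run; [ | rewrite /=; nia]).
Qed.
#[local] Hint Resolve comb_run : run.

Lemma vlen_vadd x y : vlen (vadd x y) = vlen x + vlen y.
Proof. by elim: x => //= u _ x ->. Qed.

Lemma vlen_vcomb x y : vlen (vcomb x y) <= vlen x + vlen y.
Proof. by case: x y => [|u x] [|w y] //; rewrite vlen_vadd. Qed.

(** * Cost of the three nested loops *)

Section Cost.
Variable n : nat.

(** A step takes [500 * n.+1] ([step_run]) and a loop iteration at most 50 more; the successor on
    the number of iterations pays for the last call, on the empty list. *)
Definition loop3_cost (sb : nat) := (500 * n.+1 + 50) * sb.+1.
Definition loop2_cost (sa sb : nat) := (loop3_cost sb + 50) * sa.+1.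
Definition loop1_cost (sc sa sb : nat) := (loop2_cost sa sb + 50) * sc.+1.

Lemma loop1_cost_le q sc sa sb :
  0 < q -> sc <= q -> sa <= q -> sb <= q ->
  loop1_cost sc sa sb <= 5000 * (n.+1 * q ^ 3).
Proof.
move=> q_gt0 le_c le_a le_b.
(* Each loop adds 50 to the constant and doubles it: 550 gives 1100, 1150 gives 2300, and 2350 gives
   4700. *)
have doub s : s <= q -> s.+1 <= 2 * q by lia.
have le3 : loop3_cost sb <= 1100 * (n.+1 * q).
  apply: leq_trans (leq_mul (leqnn _) (doub _ le_b)) _; nia.
have le2 : loop2_cost sa sb <= 2300 * (n.+1 * q ^ 2).
  apply: leq_trans (leq_mul (leqnn _) (doub _ le_a)) _; nia.
apply: leq_trans (leq_mul (leqnn _) (doub _ le_c)) _.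
have -> : n.+1 * q ^ 3 = n.+1 * q ^ 2 * q by rewrite -mulnA -expnSr.
have : 0 < n.+1 * q ^ 2 by rewrite muln_gt0 expn_gt0 q_gt0.
move: (n.+1 * q ^ 2) le2 => p; nia.
Qed.
End Cost.

Section Join.
Variables (n : nat) (m ma mb : seq bool) (ta tb : value).
Hypotheses (szm : size m = n) (szma : size ma = n) (szmb : size mb = n).
Hypothesis ta_len : forall z, size z = n -> vlen (lookup ta z) <= n.+1.
Hypothesis tb_len : forall z, size z = n -> vlen (lookup tb z) <= n.+1.

Definition pack : value :=
  Cons (bits m) (Cons (bits ma) (Cons ta (Cons (bits mb) tb))).

Definition step (t : value) (c ra rb : seq bool) : value :=
  let s := lxor c (lxor ra rb) in
  insert t (lsel m c s)
    (vcomb (lookup ta (lsel ma s ra)) (lookup tb (lsel mb s rb))).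

(** Entries of the child tables are at most [n.+1], which keeps unary addition and maximum linear in
    [n]. *)
Lemma step_run t c ra rb :
  size c = n -> size ra = n -> size rb = n ->
  computes f_step
    (Cons pack (Cons t (Cons (bits c) (Cons (bits ra) (bits rb)))))
    (step t c ra rb) (500 * n.+1).
Proof.
move=> szc szra szrb; rewrite /pack; run => //=.
have szs : size (lxor c (lxor ra rb)) = n by rewrite !size_lxor ?szra ?szrb.
have sza : size (lsel ma (lxor c (lxor ra rb)) ra) = n.
  by rewrite size_lsel ?szs ?szma.
have szb : size (lsel mb (lxor c (lxor ra rb)) rb) = n.
  by rewrite size_lsel ?szs ?szmb.
have := vlen_vcomb (lookup ta (lsel ma (lxor c (lxor ra rb)) ra))
  (lookup tb (lsel mb (lxor c (lxor ra rb)) rb)).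
have := ta_len sza; have := tb_len szb.
rewrite sza szb size_lsel ?szs ?szm ?szc ?szra ?szma ?szmb //; lia.
Qed.
#[local] Hint Resolve step_run : run.

Definition loop3 t c ra Rb := foldr (fun rb t => step t c ra rb) t Rb.
Definition loop2 t c Ra Rb := foldr (fun ra t => loop3 t c ra Rb) t Ra.
Definition loop1 C Ra Rb := foldr (fun c t => loop2 t c Ra Rb) Nil C.

Definition all_size (L : seq (seq bool)) := {in L, forall x, size x = n}.

Lemma all_size_cons x L : all_size (x :: L) -> size x = n /\ all_size L.
Proof.
move=> szL; split=> [|y yL]; apply: szL; first exact: mem_head.
by rewrite in_cons yL orbT.
Qed.

Lemma loop3_run t c ra Rb :
  size c = n -> size ra = n -> all_size Rb ->
  computes f_loop3
    (Cons pack (Cons t (Cons (bits c) (Cons (bits ra) (bitss Rb)))))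
    (loop3 t c ra Rb) (loop3_cost n (size Rb)).
Proof.
rewrite /loop3_cost => szc szra; elim: Rb => [|rb Rb IH].
  by move=> _; run; [ | rewrite /=; lia].
by move=> /all_size_cons[szrb /IH{}IH]; run; [ | rewrite /= [leqRHS]mulnS; lia].
Qed.
#[local] Hint Resolve loop3_run : run.

Lemma loop2_run t c Ra Rb :
  size c = n -> all_size Ra -> all_size Rb ->
  computes f_loop2
    (Cons pack (Cons t (Cons (bits c) (Cons (bitss Ra) (bitss Rb)))))
    (loop2 t c Ra Rb) (loop2_cost n (size Ra) (size Rb)).
Proof.
rewrite /loop2_cost => szc szRa szRb; elim: Ra szRa => [|ra Ra IH].
  by move=> _; run; [ | rewrite /=; lia].
move=> /all_size_cons[szra /IH{}IH].
by run; [ | rewrite /= [leqRHS]mulnS; lia].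
Qed.
#[local] Hint Resolve loop2_run : run.

Lemma loop1_run C Ra Rb :
  all_size C -> all_size Ra -> all_size Rb ->
  computes f_loop1 (Cons pack (Cons (bitss C) (Cons (bitss Ra) (bitss Rb))))
    (loop1 C Ra Rb) (loop1_cost n (size C) (size Ra) (size Rb)).
Proof.
rewrite /loop1_cost => szC szRa szRb; elim: C szC => [|c C IH].
  by move=> _; run; [ | rewrite /=; lia].
move=> /all_size_cons[szc /IH{}IH].
by run; [ | rewrite /= [leqRHS]mulnS; lia].
Qed.

End Join.

Lemma size_nodes_gt0 (V : Type) (t : dtree V) : 0 < size (nodes t).
Proof. by case: t. Qed.

(** * Running time of the whole program *)

Section Solve.
Variables (V : finType) (rows : seq (seq bool)).

Fixpoint solve (t : dtree V) : seq bool * value :=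
  match t with
  | Leaf v =>
      let e := lunit (enum_rank v) (head [::] rows) in
      (e, insert (insert (insert Nil (lxor e e) (enc_nat 1)) e (enc_nat 1))
            (lxor e (nth [::] rows (enum_rank v))) (enc_nat 2))
  | Node l r =>
      let: (ma, ta) := solve l in
      let: (mb, tb) := solve r in
      let m := lxor ma mb in
      let m' := map negb m in
      (m, loop1 m ma mb ta tb (span m' m' rows) (span ma ma rows)
                (span mb mb rows))
  end.

Variables (n q : nat).
Hypotheses (n_gt0 : 0 < n) (q_gt0 : 0 < q).
Hypotheses (sz_rows : size rows = n) (sz_row : all_size n rows).

(** This is what the time analysis needs to know about the computed values. [tractable_solve]
    supplies it from the correctness of the tables and the rank bound, with [q] a power of 2. *)
Definition tractable_root (t : dtree V) : Prop :=
  let: (m, tab) := solve t in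
  [/\ size m = n, forall z, size z = n -> vlen (lookup tab z) <= n.+1,
      size (span m m rows) <= q
    & size (span (map negb m) (map negb m) rows) <= q].

Fixpoint tractable (t : dtree V) : Prop :=
  tractable_root t /\
  if t is Node l r then tractable l /\ tractable r else True.

Local Notation cost := (n.+1 ^ 2 * q ^ 3).

Lemma tractableW t : tractable t -> tractable_root t.
Proof. by case: t => [v|l r] []. Qed.

Lemma all_size_span m ms : size m = n -> all_size n (span m ms rows).
Proof.
move=> szm; elim: ms rows sz_row => [|b ms IH] [|row rows'] szrows x;
  do ?by rewrite inE => /eqP->; rewrite size_lxor.
have [szr {}/IH IH] := all_size_cons szrows.
move=> /=; case: b; last exact: IH.
have szs : size (lsel m (lxor m m) row) = n.
  by rewrite size_lsel ?size_lxor ?szr.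
rewrite /extend; case: ifP => _; first exact: IH.
rewrite mem_cat => /orP[/mapP[y /IH szy ->]|/IH//].
by rewrite size_lxor ?szs.
Qed.

Lemma cost_ge : n.+1 * n.+1 * q <= cost.
Proof.
by rewrite mulnn leq_mul // -[leqLHS]expn1 leq_pexp2l.
Qed.

Lemma cost_ge1 : n.+1 <= cost.
Proof. by apply: leq_trans cost_ge; nia. Qed.

Lemma span_le s : s <= q -> 300 * n.+1 * n.+1 * s.+1 <= 600 * cost.
Proof. move: cost_ge => *; nia. Qed.

Lemma cost_ge3 : n.+1 * q ^ 3 <= cost.
Proof. by rewrite leq_mul // -[leqLHS]expn1 leq_pexp2l. Qed.

(** Each node is charged 9000 times [cost]: 5000 for the loops, 600 for each of the three spans, and
    the rest for vector operations. The square of [n.+1] in [cost] is due to the spans. *)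
Lemma solve_run t : tractable t ->
  let: (m, tab) := solve t in
  computes f_solve (Cons (enc_dtree t) (bitss rows)) (Cons (bits m) tab)
    (9 * (1000 * cost) * size (nodes t)).
Proof.
elim: t => [v _|l IHl r IHr].
  rewrite /=; case: rows sz_rows sz_row => [|row rows'] szr.
    by move: n_gt0; rewrite -szr.
  move=> /all_size_cons[szrow _]; rewrite [head _ _]/=.
  move: (enum_rank v) => i; have := nth_run i (row :: rows').
  move: (nth [::] _ i) => ri; cbn [vlist] => nth_i; run => //.
  have szu : size (lunit i row) = n by rewrite size_lunit.
  rewrite (size_lxor (erefl (size (lunit i row)))).
  have := leq_size_lxor (lunit i row) ri.
  rewrite szr szu szrow /= muln1; move: cost_ge; nia.
move=> tr_lr; have := tractableW tr_lr.
case: tr_lr => _ [tr_l tr_r].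
move: (tractableW tr_l) (tractableW tr_r) (IHl tr_l) (IHr tr_r).
rewrite /tractable_root /=; case: (solve l) (solve r) => [ma ta] [mb tb].
move=> [szma ta_len sz_a _] [szmb tb_len sz_b _] run_l run_r [szm _ _ szC].
set m := lxor ma mb in szm szC *; set m' := map negb m in szC *.
have szm' : size m' = n by rewrite size_map.
have run_C : span_time m' rows by apply: span_run; rewrite szm'.
have run_a : span_time ma rows by apply: span_run; rewrite szma.
have run_b : span_time mb rows by apply: span_run; rewrite szmb.
rewrite /span_time in run_C run_a run_b.
have := loop1_run szm szma szmb ta_len tb_len (@all_size_span m' m' szm')
  (@all_size_span ma ma szma) (@all_size_span mb mb szmb).
have := @loop1_cost_le n q _ _ _ q_gt0 szC sz_a sz_b.
rewrite /pack => le_loop run_loop.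
run; first by [].
rewrite [size (lxor ma mb)]szm szm' szma szmb size_cat.
move: (span_le szC) (span_le sz_a) (span_le sz_b) (cost_ge1) cost_ge3 le_loop.
move: (size (nodes l)) (size (nodes r)) (loop1_cost _ _ _ _) => sl sr cl.
move: (300 * _ * _ * _) (300 * _ * _ * _) (300 * _ * _ * _) => c1 c2 c3.
set d := 9 * (1000 * cost); rewrite (mulnS d) (mulnDr d).
move: (d * sl) (d * sr) => c4 c5; rewrite {}/d.
move: (n.+1 * q ^ 3) cost => x y; lia.
Qed.

Lemma main_run t k : tractable t ->
  lookup (solve t).2 (lxor (solve t).1 (solve t).1) = Cons Nil k ->
  computes 0 (Cons (bitss rows) (enc_dtree t)) k
    (10 * (1000 * cost) * size (nodes t)).
Proof.
move=> tr_t; have := tractableW tr_t; have := solve_run tr_t.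
rewrite /tractable_root; case: (solve t) => m tab /= run_t [szm _ _ _] tab_k.
have := lookup_run tab (lxor m m); rewrite tab_k => run_k.
run; first by [].
rewrite size_lxor // szm; have := leq_pmulr (1000 * cost) (size_nodes_gt0 t).
move: cost_ge1 (size (nodes t)) => le_cost s.
rewrite -!(mulnA _ (1000 * cost) s) -mulnA.
move: (cost * s) => cs; lia.
Qed.
End Solve.

(** * Correctness of the tables *)

Lemma vlen_enc k : vlen (enc_nat k) = k.
Proof. by elim: k => //= k ->. Qed.

Lemma vmax_enc j k : vmax (enc_nat j) (enc_nat k) = enc_nat (maxn j k).
Proof.
elim: j k => [|j IH] [|k] //.
by rewrite maxnSS /= -IH.
Qed.

Lemma vadd_enc j k : vadd (enc_nat j) (enc_nat k) = enc_nat (j + k).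
Proof. by elim: j => //= j ->. Qed.

Lemma lookup_Nil z : lookup Nil z = Nil.
Proof. by case: z. Qed.

Lemma lookup_insert t z v z' : size z = size z' ->
  lookup (insert t z v) z' =
    if z == z' then vmax (lookup t z') v else lookup t z'.
Proof.
elim: z z' t => [|b z IH] [|b' z'] t; [by [] | by [] | by [] | ].
case=> /IH{}IH; rewrite eqseq_cons.
by case: t b b' => [|t0 t1] [] [] //=; rewrite ?IH // lookup_Nil.
Qed.

Definition fill (X : seq (seq bool * nat)) t : value :=
  foldr (fun e t => insert t e.1 (enc_nat e.2)) t X.

(** Insertion keeps the maximum, and keys of equal length do not interfere in the trie, so the order
    of insertions is irrelevant. *)
Lemma lookup_fill X z : {in X, forall e, size e.1 = size z} ->
  lookup (fill X Nil) z = enc_nat (\max_(e <- X | e.1 == z) e.2).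
Proof.
elim: X => [_|e X IH sz_X]; first by rewrite big_nil lookup_Nil.
rewrite big_cons /= lookup_insert ?sz_X ?mem_head //.
rewrite IH => [|e' e'X]; last by apply: sz_X; rewrite in_cons e'X orbT.
by case: eqP => // _; rewrite vmax_enc maxnC.
Qed.

Lemma bigmax_seq_attained (T : eqType) (X : seq T) (P : pred T) (F : T -> nat) :
  0 < \max_(e <- X | P e) F e ->
  exists2 e, e \in X & P e /\ F e = \max_(e <- X | P e) F e.
Proof.
elim: X => [|e X IH]; first by rewrite big_nil.
rewrite big_cons; case: ifP => Pe; last first.
  by move=> /IH[e' e'X He']; exists e' => //; rewrite in_cons e'X orbT.
case: (leqP (F e) (\max_(e <- X | P e) F e)) => [le_e /IH|lt_e _].
  by case=> e' e'X He'; exists e' => //; rewrite in_cons e'X orbT.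
by exists e; rewrite ?mem_head.
Qed.

(** * Parity vectors over GF(2) and their spans *)

Section Vectors.
Variable G : sgraph.
Implicit Types (f g a : G -> bool) (A S : {set G}).

Definition vec f : seq bool := map f (enum G).
Definition rows : seq (seq bool) := [seq vec (adj u) | u <- enum G].

Lemma size_vec f : size (vec f) = #|G|.
Proof. by rewrite size_map cardE. Qed.

Lemma eq_vec f g : f =1 g -> vec f = vec g.
Proof. by move=> eq_fg; apply: eq_map. Qed.

Lemma vec_inj f g : vec f = vec g -> f =1 g.
Proof. by move=> /eq_in_map eq_fg v; apply: eq_fg; rewrite mem_enum. Qed.

Lemma vecP z : size z = #|G| -> exists f, z = vec f.
Proof.
move=> sz_z; exists (fun v => nth false z (enum_rank v)).
apply: (@eq_from_nth _ false) => [|i lt_i]; first by rewrite size_vec.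
have lt_iG : i < #|G| by rewrite -sz_z.
have x0 : G := enum_val (Ordinal lt_iG).
rewrite (nth_map x0) -?cardE // -(enum_val_nth x0 (Ordinal lt_iG)).
by rewrite enum_valK.
Qed.

Lemma lxor_map f g (s : seq G) :
  lxor (map f s) (map g s) = map (fun v => f v (+) g v) s.
Proof. by elim: s => //= v s ->. Qed.

Lemma lxor_vec f g : lxor (vec f) (vec g) = vec (fun v => f v (+) g v).
Proof. exact: lxor_map. Qed.

Lemma lsel_vec m f g :
  lsel (vec m) (vec f) (vec g) = vec (fun v => if m v then f v else g v).
Proof. by rewrite /vec; elim: (enum G) => //= v s ->. Qed.

Lemma neg_vec m : map negb (vec m) = vec (fun v => ~~ m v).
Proof. by rewrite -map_comp. Qed.

Lemma lunit_vec v f : lunit (enum_rank v) (vec f) = vec (pred1 v).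
Proof.
suff gen s : uniq s -> v \in s ->
    lunit (index v s) (map f s) = map (pred1 v) s.
  have -> : nat_of_ord (enum_rank v) = index v (enum G).
    by rewrite -{2}(nth_enum_rank v v) index_uniq ?enum_uniq -?cardE.
  by rewrite /vec gen ?enum_uniq ?mem_enum.
elim: s => //= u s IH /andP[us Us]; rewrite in_cons [v == u]eq_sym.
case: (eqVneq u v) => [eq_uv _ /=|_ /= vs]; last by rewrite IH.
rewrite lxor_map; congr (_ :: _); apply/eq_in_map => w ws /=.
rewrite addbb; apply/esym/negbTE; apply: contraNneq us => eq_wv.
by rewrite eq_uv -eq_wv.
Qed.

Lemma nth_rows v : nth [::] rows (enum_rank v) = vec (adj v).
Proof. by rewrite (nth_map v) -?cardE // nth_enum_rank. Qed.

(** The argument is an indicator function rather than a set, which makes [par] linear for pointwise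
    xor ([par_add]). *)
Definition par a (v : G) : bool := \big[addb/false]_(u : G) (a u && adj u v).

Lemma par_add a b v : par (fun u => a u (+) b u) v = par a v (+) par b v.
Proof.
by rewrite /par -big_split; apply: eq_bigr => u _; rewrite andb_addl.
Qed.

Lemma eq_par a b v : a =1 b -> par a v = par b v.
Proof. by move=> eq_ab; apply: eq_bigr => u _; rewrite eq_ab. Qed.

Lemma par0 v : par (fun=> false) v = false.
Proof. by rewrite /par big1. Qed.

Lemma par1 u v : par (pred1 u) v = adj u v.
Proof.
rewrite /par (bigD1 u) //= eqxx /= big1 ?addbF // => w /negbTE wu.
by rewrite wu.
Qed.

Lemma parU S1 S2 v : [disjoint S1 & S2] ->
  par (mem (S1 :|: S2)) v = par (mem S1) v (+) par (mem S2) v.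
Proof.
move=> dis; rewrite -par_add; apply: eq_par => u /=; rewrite inE.
by case: (boolP (u \in S1)) => // uS1; rewrite (disjointFr dis uS1).
Qed.

Definition masked m a := vec (fun v => ~~ m v && par a v).

Lemma eq_masked m a b : a =1 b -> masked m a = masked m b.
Proof. by move=> eq_ab; apply: eq_vec => v; rewrite (eq_par v eq_ab). Qed.

Lemma lxor_masked m a b :
  lxor (masked m a) (masked m b) = masked m (fun u => a u (+) b u).
Proof. by rewrite lxor_vec; apply: eq_vec => v; rewrite par_add andb_addr. Qed.

(** For [P] equal to [m], the listed vectors are the row space of the cut matrix of [m], padded with
    zeros on [m]. *)
Definition spans m (P : pred G) (L : seq (seq bool)) :=
  forall x, x \in L <-> exists2 a, subpred a P & x = masked m a.

(** [L] is a subspace. If it contains the new generator, it is already the extended span; otherwise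
    the coset of the generator is disjoint from [L], and concatenation creates no duplicate. *)
Lemma extend_spans m (P : pred G) L u : uniq L -> spans m P L ->
  uniq (extend (masked m (pred1 u)) L) /\
  spans m (fun w => (w == u) || P w) (extend (masked m (pred1 u)) L).
Proof.
set x0 := masked m _ => uniqL spanL.
have closed x y : x \in L -> y \in L -> lxor x y \in L.
  move=> /spanL[a aP ->] /spanL[b bP ->]; rewrite lxor_masked.
  apply/spanL; exists (fun u => a u (+) b u) => // w.
  by case: (boolP (a w)) => [/aP|_ /bP].
have xorK (x y : seq bool) : size x = #|G| -> size y = #|G| ->
    lxor x (lxor x y) = y.
  move=> /vecP[f ->] /vecP[g ->]; rewrite !lxor_vec; apply: eq_vec => v.
  by rewrite addKb.
have sz_x0 : size x0 = #|G| by rewrite size_vec.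
have szL x : x \in L -> size x = #|G|.
  by move=> /spanL[a _ ->]; rewrite size_vec.
split.
  rewrite /extend; case: ifPn => // x0L; rewrite cat_uniq uniqL andbT.
  apply/andP; split.
    rewrite map_inj_in_uniq // => x y /szL szx /szL szy eq_xy.
    by rewrite -(xorK x0 x) // eq_xy xorK.
  apply/hasPn => x xL; apply: contra x0L => /mapP[y yL def_x].
  suff -> : x0 = lxor y x by apply: closed.
  rewrite def_x; have [f ->] := vecP sz_x0; have [g ->] := vecP (szL _ yL).
  by rewrite !lxor_vec; apply: eq_vec => v; rewrite addbC addbK.
have x0_add a : lxor x0 (masked m a) = masked m (fun v => (v == u) (+) a v).
  by rewrite lxor_masked; apply: eq_masked.
have extendW x : x \in L -> x \in extend x0 L.
  by rewrite /extend; case: ifP => // _ xL; rewrite mem_cat xL orbT.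
have extend_xor x : x \in L -> lxor x0 x \in extend x0 L.
  rewrite /extend; case: ifP => [x0L xL|_ xL]; first exact: closed.
  by rewrite mem_cat map_f.
move=> x; split=> [|[a aP ->]].
  have old y : y \in L ->
      exists2 a, subpred a (fun w => (w == u) || P w) & y = masked m a.
    by move=> /spanL[a aP ->]; exists a => // w /aP ->; rewrite orbT.
  rewrite /extend; case: ifP => _; first exact: old.
  rewrite mem_cat => /orP[/mapP[y /spanL[a aP ->] ->]|]; last exact: old.
  rewrite x0_add; exists (fun v => (v == u) (+) a v) => // w.
  by case: eqP => //= _ /aP.
have [au|au] := boolP (a u); last first.
  apply/extendW/spanL; exists a => // w aw; have := aP w aw.
  by case: eqP aw => // ->; rewrite (negbTE au).
(* When [a] uses [u], the generator is split off; xor with the indicator of [u] removes [u] from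
   [a]. *)
have -> : masked m a = lxor x0 (masked m (fun v => (v == u) (+) a v)).
  by rewrite x0_add; apply: eq_masked => w; rewrite addKb.
apply/extend_xor/spanL; exists (fun v => (v == u) (+) a v) => // w.
have := aP w; case: eqP => [->|_ /=]; first by rewrite au.
by [].
Qed.

Lemma span_vec m :
  uniq (span (vec m) (vec m) rows) /\ spans m m (span (vec m) (vec m) rows).
Proof.
(* The recursion consumes the selecting mask and the rows together while the restricting mask stays
   whole, so the claim is generalized to a list [s] of vertices. *)
suff gen s : uniq (span (vec m) (map m s) [seq vec (adj u) | u <- s]) /\
    spans m (fun v => m v && (v \in s))
      (span (vec m) (map m s) [seq vec (adj u) | u <- s]).
  have [uniqL spanL] := gen (enum G); split=> // x.
  split=> [/spanL|] [a aP ->]; [|apply/spanL]; exists a => // w /aP.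
    by case/andP.
  by rewrite mem_enum andbT.
elim: s => [|u s [uniqL spanL]].
  split=> // x; rewrite inE lxor_vec.
  have zero : vec (fun v => m v (+) m v) = masked m (fun=> false).
    by apply: eq_vec => v; rewrite addbb par0 andbF.
  rewrite zero; split=> [/eqP ->|[a aP ->]]; first by exists (fun=> false).
  apply/eqP; apply: eq_masked => v; by apply/negbTE/negP => /aP; rewrite andbF.
rewrite [span _ _ _]/=; case: (boolP (m u)) => mu.
  have -> : lsel (vec m) (lxor (vec m) (vec m)) (vec (adj u)) =
      masked m (pred1 u).
    rewrite lxor_vec lsel_vec; apply: eq_vec => v.
    by rewrite addbb par1; case: (m v).
  have [uniqL' spanL'] := extend_spans u uniqL spanL; split=> // x.
  split=> [/spanL'|] [a aP ->]; [|apply/spanL']; exists a => // w /aP;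
    rewrite !inE.
    by case: eqP => [->|_] //=; rewrite mu.
  by case: eqP => [->|_] //=.
split=> // x; split=> [/spanL|] [a aP ->]; [|apply/spanL]; exists a => // w /aP.
  by case/andP=> -> ws; rewrite in_cons ws orbT.
by rewrite in_cons; case: eqP => [->|_] //; rewrite (negbTE mu).
Qed.
End Vectors.

(** * The number of parity vectors and the cut rank *)

Section Rank.
Variable G : sgraph.

(** A masked parity vector is [y *m M] for the coordinate vector [y] of its vertex set, hence a
    combination of [row_base M], and there are [2 ^ \rank M] of these. The list has no duplicates,
    so its length obeys the same bound. [M] is left abstract to cover both the cut matrix and its
    transpose. *)
Lemma span_size (B C : {set G}) (M : 'M['F_2]_(#|B|, #|C|)) :
  (forall i j, M i j = (adj (enum_val i) (enum_val j))%:R%R) ->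
  (forall v, (v \in C) = (v \notin B)) ->
  size (span (vec (mem B)) (vec (mem B)) (rows G)) <= 2 ^ \rank M.
Proof.
move=> M_adj C_def; set L := span _ _ _.
have [uniqL spanL] := span_vec (mem B : pred G).
(* [read] extends a row vector indexed by [C] by zero to all of [G]; the existential avoids a
   membership proof for the index. *)
pose read (w : 'rV['F_2]_#|C|) : seq bool := vec (fun v : G =>
  [exists j, (enum_val j == v) && (w ord0 j != 0%R)]).
pose W := [seq read (x *m row_base M)%R | x : 'rV['F_2]_(\rank M)].
have sizeW : size W = 2 ^ \rank M.
  by rewrite size_map -cardE card_mx card_Fp // mul1n.
rewrite -sizeW; apply: uniq_leq_size => // x /spanL[a aB ->].
pose y : 'rV['F_2]_#|B| := (\row_i (a (enum_val i))%:R)%R.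
suff -> : masked (mem B) a = read (y *m M)%R.
  by rewrite -[M in (y *m M)%R]mulmx_base mulmxA; apply: image_f.
have add_F2 (b c : bool) : ((b (+) c)%:R = b%:R + c%:R :> 'F_2)%R.
  by case: b c => [] []; apply/val_inj.
have par_F2 j : (y *m M)%R ord0 j = ((par a (enum_val j))%:R)%R.
  rewrite mxE /par.
  rewrite (big_morph (fun b : bool => (b%:R : 'F_2)%R) add_F2 (erefl _)).
  rewrite (bigID (mem B)) /= [X in (_ + X)%R]big1 ?GRing.addr0; last first.
    by move=> u uB; case: (boolP (a u)) => [/aB|//] /=; rewrite (negbTE uB).
  rewrite (big_enum_val (fun u => ((a u && adj u (enum_val j))%:R)%R)).
  by apply: eq_bigr => i _; rewrite mxE M_adj -GRing.natrM mulnb.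
apply: eq_vec => v; rewrite -C_def; apply/andP/existsP => [[vC par_v]|].
  exists (enum_rank_in vC v).
  by rewrite par_F2 enum_rankK_in ?eqxx // par_v.
move=> [j /andP[/eqP <-]]; rewrite par_F2 enum_valP; by case: (par _ _).
Qed.

Lemma span_cut (A : {set G}) :
  size (span (vec (mem A)) (vec (mem A)) (rows G)) <= 2 ^ \rank (cut_matrix A).
Proof. by apply: span_size => [i j|v]; rewrite ?mxE ?inE. Qed.

(** Vertices outside [A] span the column space of the cut matrix, and transposition preserves the
    rank. *)
Lemma span_cutC (A : {set G}) :
  let m := vec (fun v => v \notin A) in
  size (span m m (rows G)) <= 2 ^ \rank (cut_matrix A).
Proof.
have -> : vec (fun v => v \notin A) = vec (mem (~: A)).
  by apply: eq_vec => v /=; rewrite inE.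
rewrite /= -mxrank_tr; apply: span_size => [i j|v]; last by rewrite !inE negbK.
by rewrite !mxE adj_sym.
Qed.
End Rank.

(** * Specification of the tables and the leaf case *)

Section Table.
Variable G : sgraph.
Implicit Types (A S : {set G}) (z a : G -> bool).

(* Outside [A], [z] records the adjacency of [S]; inside, it is the parity
   contributed by the rest of the odd subgraph. *)
Definition solution A z S : Prop :=
  S \subset A /\ forall v,
    if v \in A then v \in S -> par (mem S) v != z v else par (mem S) v = z v.

(* The last clause only covers keys whose part on [A] can be realized by
   vertices outside [A]: the others are not enumerated. *)
Definition correct_table A tab : Prop := forall z,
  let k := vlen (lookup tab (vec z)) in
  [/\ lookup tab (vec z) = enc_nat k,
      0 < k -> exists2 S, solution A z S & k = #|S|.+1
    & forall S a, solution A z S -> subpred a (fun u => u \notin A) ->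
        {in A, forall v, z v = par a v} -> #|S| < k].

(** Since a filled table stores maxima, soundness can be checked entry by entry, and completeness
    only asks for one entry that dominates a given solution. *)
Lemma correct_table_fill A (X : seq (seq bool * nat)) :
  {in X, forall e, size e.1 = #|G|} ->
  (forall e z, e \in X -> e.1 = vec z -> 0 < e.2 ->
     exists2 S, solution A z S & e.2 = #|S|.+1) ->
  (forall z S a, solution A z S -> subpred a (fun u => u \notin A) ->
     {in A, forall v, z v = par a v} ->
     exists2 e, e \in X & e.1 = vec z /\ #|S| < e.2) ->
  correct_table A (fill X Nil).
Proof.
move=> sz_X sound complete z.
rewrite lookup_fill => [|e eX]; last by rewrite size_vec sz_X.
rewrite vlen_enc; split=> // [k_gt0|S a solS a_out z_a].
  have [e eX [/eqP e_z def_e]] := bigmax_seq_attained k_gt0.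
  by rewrite -def_e in k_gt0 *; apply: sound.
have [e eX [e_z lt_e]] := complete z S a solS a_out z_a.
by apply: leq_trans lt_e _; apply: leq_bigmax_seq => //; rewrite e_z.
Qed.

Lemma par_set0 v : par (mem (set0 : {set G})) v = false.
Proof. by rewrite -[RHS](par0 v); apply: eq_par => u /=; rewrite inE. Qed.

Lemma par_set1 u v : par (mem [set u : G]) v = adj u v.
Proof. by rewrite -par1; apply: eq_par => w /=; rewrite inE. Qed.

Lemma solution_set0 v z :
  solution [set v] z set0 <-> (forall w, w != v -> z w = false).
Proof.
split=> [[_ sol] w|z0]; last (split; [exact: sub0set|move=> w]).
  by move=> wv; have := sol w; rewrite in_set1 (negbTE wv) par_set0.
by rewrite !inE; case: eqP => // /eqP wv; rewrite par_set0 z0.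
Qed.

Lemma solution_set1 v z :
  solution [set v] z [set v] <-> (z =1 fun w => (w == v) (+) adj v w).
Proof.
split=> [[_ sol] w|zE].
  have := sol w; rewrite !inE par_set1; case: eqP => [->|_ -> //] /(_ isT).
  by rewrite adj_irrefl; case: (z v).
split=> // w; rewrite inE par_set1 zE; case: eqP => [->|] //.
by rewrite adj_irrefl.
Qed.

Lemma solve_leaf (v : G) :
  correct_table [set v] (solve (rows G) (Leaf v)).2.
Proof.
have headE : lunit (enum_rank v) (head [::] (rows G)) = vec (pred1 v).
  rewrite /rows; case: (enum G) (mem_enum G v) => // u s _.
  exact: lunit_vec.
rewrite /solve nth_rows headE !lxor_vec /=.
pose X := [:: (vec (fun w => (w == v) (+) adj v w), 2); (vec (pred1 v), 1);
  (vec (fun w => (w == v) (+) (w == v)), 1)].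
apply: (@correct_table_fill _ X) => [e|e z|z S a solS _ _].
- by rewrite !inE => /or3P[]/eqP->; rewrite size_vec.
- have sol0 (f : G -> bool) : (forall w, w != v -> f w = false) ->
      vec f = vec z -> exists2 S, solution [set v] z S & 1 = #|S|.+1.
    move=> f0 /vec_inj fz; exists set0; last by rewrite cards0.
    by apply/solution_set0 => w wv; rewrite -fz f0.
  rewrite !inE => /or3P[]/eqP-> /=.
  + move=> /vec_inj fz _; exists [set v]; last by rewrite cards1.
    by apply/solution_set1 => w; rewrite -fz.
  + by move=> /sol0 sol _; apply: sol => w /negbTE.
  + by move=> /sol0 sol _; apply: sol => w _; rewrite addbb.
- have [+ _] := solS; rewrite subset1 => /orP[]/eqP eq_S;
    rewrite {}eq_S in solS *; last first.
    have /solution_set0 z0 := solS; rewrite cards0.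
    (* The key vanishes off [v], so the bit [z v] decides which of the two entries for the empty set
       applies. *)
    exists (vec (fun w => (w == v) && z v), 1).
      case: (z v); rewrite ?inE; apply/or3P; [apply: Or32 | apply: Or33];
        by apply/eqP; congr (_, _); apply: eq_vec => w /=;
        rewrite ?addbb ?andbT ?andbF.
    split=> //; apply: eq_vec => w /=.
    by case: (eqVneq w v) => [->|/z0 ->].
  have /solution_set1 zE := solS.
  exists (vec (fun w => (w == v) (+) adj v w), 2); first by rewrite mem_head.
  by rewrite cards1; split=> //; apply: eq_vec.
Qed.
End Table.

(** * The nested loops as one list of table entries *)

Definition ncomb j k := if (0 < j) && (0 < k) then (j + k).-1 else 0.

Lemma vcomb_enc j k : vcomb (enc_nat j) (enc_nat k) = enc_nat (ncomb j k).
Proof.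
case: j k => [|j] [|k] //.
by rewrite -[vcomb _ _]/(vadd _ (enc_nat k.+1)) vadd_enc.
Qed.

Section LoopFill.
Variables (n : nat) (m ma mb : seq bool) (ta tb : value).
Hypotheses (szm : size m = n) (szma : size ma = n) (szmb : size mb = n).
Hypothesis ta_enc :
  forall z, size z = n -> lookup ta z = enc_nat (vlen (lookup ta z)).
Hypothesis tb_enc :
  forall z, size z = n -> lookup tb z = enc_nat (vlen (lookup tb z)).

Definition entry c ra rb :=
  let s := lxor c (lxor ra rb) in
  (lsel m c s, ncomb (vlen (lookup ta (lsel ma s ra)))
                     (vlen (lookup tb (lsel mb s rb)))).

Definition entries C Ra Rb :=
  flatten [seq [seq entry c ra rb | ra <- Ra, rb <- Rb] | c <- C].

(** The loops are nested folds, so they amount to one fold over the concatenated entries. Lookups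
    being unary numbers, [vcomb] can be read as [ncomb] on naturals. *)
Lemma loop1_fill C Ra Rb :
  all_size n C -> all_size n Ra -> all_size n Rb ->
  loop1 m ma mb ta tb C Ra Rb = fill (entries C Ra Rb) Nil.
Proof.
move=> szC szRa szRb.
have fill_cat X Y t : fill (X ++ Y) t = fill X (fill Y t) by apply: foldr_cat.
have step_fill t c ra rb : size c = n -> size ra = n -> size rb = n ->
    step m ma mb ta tb t c ra rb = fill [:: entry c ra rb] t.
  move=> szc szra szrb; rewrite /step /entry /= -vcomb_enc.
  have szs : size (lxor c (lxor ra rb)) = n by rewrite !size_lxor ?szra ?szrb.
  by rewrite -ta_enc ?size_lsel ?szs ?szma // -tb_enc ?size_lsel ?szs ?szmb.
have loop3_fill t c ra : size c = n -> size ra = n ->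
    loop3 m ma mb ta tb t c ra Rb = fill [seq entry c ra rb | rb <- Rb] t.
  move=> szc szra; elim: Rb szRb => //= rb Rb' IH /all_size_cons[szrb /IH ->].
  exact: step_fill.
have loop2_fill t c : size c = n ->
    loop2 m ma mb ta tb t c Ra Rb =
    fill [seq entry c ra rb | ra <- Ra, rb <- Rb] t.
  move=> szc; elim: Ra szRa => //= ra Ra' IH /all_size_cons[szra /IH ->].
  by rewrite loop3_fill // fill_cat.
elim: C szC => //= c C IH /all_size_cons[szc /IH ->].
by rewrite loop2_fill // -fill_cat.
Qed.
End LoopFill.

(** * Correctness of the join *)

Section JoinCorrect.
Variable G : sgraph.
Implicit Types (A B S : {set G}) (c z a ra rb : G -> bool).

Lemma eq_solution A z z' S : z =1 z' -> solution A z S -> solution A z' S.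
Proof. by move=> eq_z [SA sol]; split=> // v; have := sol v; rewrite eq_z. Qed.

(** On [A] the vector [s] is [c] plus [rb], and [Sb] contributes exactly [rb] there; the two copies
    of [rb] cancel and leave the condition for [c]. The case of [B] is symmetric. Outside both, [c]
    vanishes and the parities add up to [s]. *)
Lemma solution_join A B c ra rb Sa Sb :
  let s v := c v (+) (ra v (+) rb v) in
  [disjoint A & B] -> (forall v, v \notin A :|: B -> c v = false) ->
  {in A, forall v, ra v = false} -> {in B, forall v, rb v = false} ->
  solution A (fun v => if v \in A then s v else ra v) Sa ->
  solution B (fun v => if v \in B then s v else rb v) Sb ->
  solution (A :|: B) (fun v => if v \in A :|: B then c v else s v) (Sa :|: Sb).
Proof.
move=> s disAB c0 ra0 rb0 [SaA sola] [SbB solb].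
have dis_S : [disjoint Sa & Sb] by exact: disjointW SaA SbB disAB.
split=> [|v]; first exact: setUSS.
rewrite parU //; have := sola v; have := solb v; have := c0 v.
rewrite /s in_setU in_setU.
case: (boolP (v \in A)) => [vA|vA].
  rewrite (disjointFr disAB vA) (ra0 v vA) => _ ->.
  have /negbTE-> : v \notin Sb.
    by apply: contraFN (disjointFr disAB vA); apply: subsetP.
  rewrite /= orbF => H /H.
  by case: (par _ v) (rb v) (c v) => [] [] [].
have /negbTE-> : v \notin Sa by apply: contra vA; apply: subsetP.
case: (boolP (v \in B)) => [vB|vB] /=; last by move=> -> // -> ->.
rewrite (rb0 v vB) => _ H -> /H.
by case: (par _ v) (ra v) (c v) => [] [] [].
Qed.

(** Seen from [A], the part of [S] in [B] belongs to the outside, so its parity moves into the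
    key. *)
Lemma solution_split A B z S : [disjoint A & B] ->
  solution (A :|: B) z S ->
  solution A (fun v => if v \in A then z v (+) par (mem (S :&: B)) v
                       else par (mem (S :&: A)) v) (S :&: A).
Proof.
move=> disAB [SAB sol]; split=> [|v]; first exact: subsetIr.
have def_S : S = (S :&: A) :|: (S :&: B).
  by rewrite -setIUr; apply/esym/setIidPl.
have dis_S : [disjoint S :&: A & S :&: B].
  exact: disjointW (subsetIr _ _) (subsetIr _ _) disAB.
case: (boolP (v \in A)) => // vA.
have := sol v; rewrite !inE vA /= andbT => H /H.
rewrite {1}def_S parU //.
by case: (par _ v) (par _ v) (z v) => [] [] [].
Qed.

Lemma join_correct A B ta tb :
  [disjoint A & B] -> correct_table A ta -> correct_table B tb ->
  let m := vec (fun v => v \in A :|: B) in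
  let m' := vec (fun v => v \notin A :|: B) in
  let ma := vec (fun v => v \in A) in
  let mb := vec (fun v => v \in B) in
  correct_table (A :|: B)
    (loop1 m ma mb ta tb (span m' m' (rows G)) (span ma ma (rows G))
      (span mb mb (rows G))).
Proof.
move=> disAB cor_a cor_b m m' ma mb.
have [_ spanC] := span_vec (fun v => v \notin A :|: B).
have [_ span_a] := span_vec (fun v => v \in A).
have [_ span_b] := span_vec (fun v => v \in B).
set C := span m' m' _; set Ra := span ma ma _; set Rb := span mb mb _.
rewrite -/C in spanC; rewrite -/Ra in span_a; rewrite -/Rb in span_b.
have enc A' tab' : correct_table A' tab' -> forall z : seq bool,
    size z = #|G| -> lookup tab' z = enc_nat (vlen (lookup tab' z)).
  by move=> cor z /vecP[f ->]; case: (cor f).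
have szC : all_size #|G| C by move=> x /spanC[a _ ->]; rewrite size_vec.
have sza : all_size #|G| Ra by move=> x /span_a[a _ ->]; rewrite size_vec.
have szb : all_size #|G| Rb by move=> x /span_b[a _ ->]; rewrite size_vec.
rewrite (@loop1_fill #|G|) ?size_vec //; try exact: enc.
pose s (c ra rb : G -> bool) v := c v (+) (ra v (+) rb v).
have entryE c ra rb : entry m ma mb ta tb (vec c) (vec ra) (vec rb) =
    (vec (fun v => if v \in A :|: B then c v else s c ra rb v),
     ncomb
      (vlen (lookup ta (vec (fun v => if v \in A then s c ra rb v else ra v))))
      (vlen
        (lookup tb (vec (fun v => if v \in B then s c ra rb v else rb v))))).
  by rewrite /entry !lxor_vec !lsel_vec.
have entriesP e : e \in entries m ma mb ta tb C Ra Rb <->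
    exists (c ra rb : seq bool),
      [/\ c \in C, ra \in Ra, rb \in Rb & e = entry m ma mb ta tb c ra rb].
  split=> [/flatten_mapP[c cC /allpairsP[[ra rb] [raR rbR ->]]]|].
    by exists c, ra, rb.
  move=> [c [ra [rb [cC raR rbR ->]]]]; apply/flatten_mapP; exists c => //.
  by apply/allpairsP; exists (ra, rb).
apply: correct_table_fill => [e|e z|z S a solS a_out z_a].
- case/entriesP=> c [ra [rb [/szC szc /sza szra /szb szrb ->]]].
  by rewrite /entry /= size_lsel ?size_lxor ?size_vec ?szc ?szra ?szrb.
- case/entriesP=> x [y [w [/spanC[ac _ ->] /span_a[aa _ ->]]]].
  move=> /span_b[ab _ ->] ->.
  rewrite /masked entryE; set c := fun v => _ && _; set ra := fun v => _ && _.
  set rb := fun v => _ && _ => /= /vec_inj eq_z.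
  rewrite /ncomb; case: ifP => // /andP[ka kb] _.
  have [_ /(_ ka)[Sa sola ->] _] :=
    cor_a (fun v => if v \in A then s c ra rb v else ra v).
  have [_ /(_ kb)[Sb solb ->] _] :=
    cor_b (fun v => if v \in B then s c ra rb v else rb v).
  exists (Sa :|: Sb); last first.
    have dis_S : [disjoint Sa & Sb].
      exact: disjointW (proj1 sola) (proj1 solb) disAB.
    move: dis_S; rewrite -leq_card_setU => /eqP->; lia.
  apply: eq_solution eq_z _; apply: solution_join => // v.
  + by move=> vAB; rewrite /c vAB.
  + by move=> vA; rewrite /ra vA.
  + by move=> vB; rewrite /rb vB.
(* Completeness: the triple that yields the key [z] takes [c] from the outer set [a], and [ra], [rb]
   from the two parts of [S]. *)
- pose Sa := S :&: A; pose Sb := S :&: B.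
  pose c v := ~~ (v \notin A :|: B) && par a v.
  pose ra v := ~~ (v \in A) && par (mem Sa) v.
  pose rb v := ~~ (v \in B) && par (mem Sb) v.
  have def_S : S = Sa :|: Sb.
    by rewrite /Sa /Sb -setIUr; apply/esym/setIidPl; case: solS.
  have dis_S : [disjoint Sa & Sb].
    exact: disjointW (subsetIr _ _) (subsetIr _ _) disAB.
  exists (entry m ma mb ta tb (vec c) (vec ra) (vec rb)).
    apply/entriesP; exists (vec c), (vec ra), (vec rb); split=> //.
    + by apply/spanC; exists a => // v /a_out.
    + by apply/span_a; exists (mem Sa) => // v /setIP[].
    + by apply/span_b; exists (mem Sb) => // v /setIP[].
  rewrite entryE; split.
    apply: eq_vec => v; case: ifPn => vAB.
      by rewrite /c vAB z_a.
    have [_ /(_ v)] := solS; rewrite (negbTE vAB) => <-.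
    rewrite /s /c vAB {1}def_S parU // /ra /rb.
    by move: vAB; rewrite inE negb_or => /andP[-> ->].
  (* For a child, the realizing outer set is [a] together with the part of [S] in the sibling; these
     are disjoint, so xor is their union. *)
  have [_ _ /(_ Sa (fun v => a v (+) (v \in Sb)))] :=
    cor_a (fun v => if v \in A then s c ra rb v else ra v).
  have [_ _ /(_ Sb (fun v => a v (+) (v \in Sa)))] :=
    cor_b (fun v => if v \in B then s c ra rb v else rb v).
  set kb := vlen _; set ka := vlen _ => Hb Ha.
  have lt_a : #|Sa| < ka.
    apply: Ha.
    + have := solution_split disAB solS; apply: eq_solution => v.
      rewrite /s /c /ra /rb; case: ifP => vA //=.
      by rewrite (disjointFr disAB vA) inE vA /= -z_a ?inE ?vA.
    + move=> v; case: (boolP (v \in Sb)) => [vSb _|_]; last first.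
        by rewrite addbF => /a_out; rewrite inE negb_or => /andP[].
      by move: vSb; rewrite inE => /andP[_ vB]; rewrite (disjointFl disAB vB).
    + move=> v vA; rewrite vA par_add /s /c /ra /rb vA (disjointFr disAB vA).
      by rewrite inE vA.
  have lt_b : #|Sb| < kb.
    apply: Hb.
    + rewrite disjoint_sym in disAB; rewrite setUC in solS.
      have := solution_split disAB solS; apply: eq_solution => v.
      rewrite /s /c /ra /rb; case: ifP => vB //=.
      rewrite (disjointFr disAB vB) inE vB orbT /= -z_a ?inE ?vB ?orbT //.
      by rewrite addbF.
    + move=> v; case: (boolP (v \in Sa)) => [vSa _|_]; last first.
        by rewrite addbF => /a_out; rewrite inE negb_or => /andP[].
      by move: vSa; rewrite inE => /andP[_ vA]; rewrite (disjointFr disAB vA).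
    + move=> v vB; rewrite vB par_add /s /c /ra /rb vB (disjointFl disAB vB).
      by rewrite inE vB orbT /= addbF.
  (* Each child entry exceeds its size by at least one, so the sum minus one still exceeds the total
     size. *)
  rewrite /ncomb {1}def_S /=.
  move: dis_S; rewrite -leq_card_setU => /eqP->; case: ifP; lia.
Qed.
End JoinCorrect.

(** * From the root table to the maximum odd induced subgraph *)

Section MaxOdd.
Variable G : sgraph.
Implicit Type S : {set G}.

Lemma par_odd S v : par (mem S) v = odd #|[set u in S | adj v u]|.
Proof.
rewrite -sum1_card (big_morph odd oddD (erefl _)) big_mkcond /par.
by apply: eq_bigr => u _; rewrite inE adj_sym /=; case: ifP.
Qed.

Lemma degree_induced S (v : induced S) :
  degree v = #|[set u in S | adj (val v) u]|.
Proof.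
rewrite /degree -(card_imset _ val_inj); apply: eq_card => u; rewrite inE.
apply/imsetP/andP => [[w] |[uS uv]].
  by rewrite inE => vw ->; split=> //; apply: (valP w).
by exists (Sub u uS : induced S); rewrite ?inE.
Qed.

(** With no vertex outside, only the condition on [S] remains, and differing from the zero key means
    odd degree within [S]. *)
Lemma solution_setT S :
  solution [set: G] (fun=> false) S <-> odd_graph (induced S).
Proof.
split=> [[_ sol]|/forallP odd_S].
  apply/forallP => v; rewrite degree_induced -par_odd.
  by have := sol (val v); rewrite inE => /(_ (valP v)); case: (par _ _).
split=> [|v]; first exact: subsetT.
rewrite inE => vS; have := odd_S (Sub v vS : induced S).
by rewrite degree_induced -par_odd SubK => ->.
Qed.

Lemma correct_table_max_odd tab : correct_table [set: G] tab ->
  lookup tab (vec (fun _ : G => false)) = enc_nat (max_odd G).+1.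
Proof.
move=> /(_ (fun=> false)); cbv zeta; move: (lookup _ _) => w.
move=> [w_k sound complete].
rewrite {}w_k; congr enc_nat; move: (vlen w) sound complete => k sound complete.
have lt_k S : odd_graph (induced S) -> #|S| < k.
  move=> /solution_setT solS; apply: (complete S (fun=> false)) => // v _.
  by rewrite par0.
(* The empty set forces a nonzero entry, so the entry is attained by some odd set. *)
have odd0 : odd_graph (induced (set0 : {set G})).
  by apply/forallP => -[v vS]; have := vS; rewrite inE.
have k_gt0 : 0 < k by apply: leq_ltn_trans (lt_k _ odd0).
have [S /solution_setT oddS def_k] := sound k_gt0.
apply/eqP; rewrite eqn_leq {1}def_k ltnS; apply/andP; split.
  exact: (@leq_bigmax_cond _ (fun S => odd_graph (induced S))).
by rewrite -[k]prednK // ltnS; apply/bigmax_leqP => S' /lt_k; lia.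
Qed.

(** Distinct leaves make the vertex sets of the two children disjoint, so the xor of their masks is
    the mask of the union. *)
Lemma solve_correct (t : dtree G) : uniq (leaves t) ->
  (solve (rows G) t).1 = vec (fun v => v \in leaves t) /\
  correct_table [set v in leaves t] (solve (rows G) t).2.
Proof.
elim: t => [v _|l IHl r IHr].
  split; last first.
    have -> : [set w in leaves (Leaf v)] = [set v].
      by apply/setP => u; rewrite !inE.
    exact: solve_leaf.
  rewrite /= /rows; case: (enum G) (mem_enum G v) => // u s _.
  rewrite lunit_vec; by apply: eq_vec => w; rewrite mem_seq1.
rewrite [leaves _]/= cat_uniq => /and3P[/IHl{IHl}[]].
move=> + + dis /IHr{IHr}[]; rewrite /=.
case: (solve _ l) (solve _ r) => [ma ta] [mb tb] /= -> cor_a -> cor_b.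
have dis_lr : [disjoint [set v in leaves l] & [set v in leaves r]].
  apply/pred0P => v /=; rewrite !inE; apply/negbTE; apply: contra dis.
  by case/andP=> vl vr; apply/hasP; exists v.
have setE : [set v in leaves l ++ leaves r] =
    [set v in leaves l] :|: [set v in leaves r].
  by apply/setP => v; rewrite !inE mem_cat.
have maE (s : seq G) :
    vec (fun v => v \in s) = vec (fun v => v \in [set w in s]).
  by apply: eq_vec => v; rewrite inE.
have mE : lxor (vec (fun v => v \in leaves l)) (vec (fun v => v \in leaves r)) =
    vec (fun v => v \in [set v in leaves l] :|: [set v in leaves r]).
  rewrite lxor_vec; apply: eq_vec => v; rewrite !inE.
  have := disjointFr dis_lr (x := v); rewrite !inE.
  by case: (v \in leaves l) => // ->.
split; first by rewrite mE; apply: eq_vec => v; rewrite !inE mem_cat.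
rewrite mE !maE neg_vec setE; exact: join_correct.
Qed.

(** A nonzero entry is the size of a vertex set plus one, and both spans are bounded by the cut rank
    at the node. The bound [r] stays fixed as the induction descends to subtrees, whose nodes are
    among those of [t]. *)
Lemma tractable_solve (t : dtree G) r : uniq (leaves t) -> rank_width t <= r ->
  tractable (rows G) #|G| (2 ^ r) t.
Proof.
have root (t' : dtree G) : uniq (leaves t') -> rank_width t' <= r ->
    tractable_root (rows G) #|G| (2 ^ r) t'.
  move=> uniq_t; have [] := solve_correct uniq_t; rewrite /tractable_root.
  set A := [set v in leaves t'].
  case: (solve _ t') => m tab /= -> cor_tab le_r.
  have le_cut : 2 ^ \rank (cut_matrix A) <= 2 ^ r.
    rewrite leq_exp2l //; apply: leq_trans le_r; rewrite /rank_width.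
    by rewrite /A; case: (t') => [v|? ?]; rewrite big_cons leq_maxl.
  have mE : vec (fun v => v \in leaves t') = vec (mem A).
    by apply: eq_vec => v; rewrite /= inE.
  rewrite mE; split; first by rewrite size_vec.
  - move=> z /vecP[f ->]; have [_ sound _] := cor_tab f.
    by case: posnP sound => [->//|_ /(_ isT)[S _ ->]]; rewrite ltnS max_card.
  - exact: leq_trans (span_cut A) le_cut.
  - by rewrite neg_vec; exact: leq_trans (span_cutC A) le_cut.
elim: t => [v|l IHl s IHs] uniq_t le_r; split; try exact: root; first by [].
move: uniq_t le_r; rewrite /= cat_uniq => /and3P[uniq_l _ uniq_s].
rewrite /rank_width big_cons big_cat /= !geq_max => /and3P[_ le_l le_s].
by split; [apply: IHl | apply: IHs].
Qed.

Lemma enc_graph_bits : enc_graph G = bitss (rows G).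
Proof.
have enc_map (T U : Type) (f : T -> U) (enc : U -> value) (s : seq T) :
    enc_seq [seq enc (f x) | x <- s] = vlist enc (map f s).
  by elim: s => //= x s ->.
rewrite /enc_graph /rows -enc_map; congr enc_seq; apply: eq_map => u.
rewrite /vec -enc_map; congr enc_seq; apply: eq_map => v.
by case: (adj u v).
Qed.
End MaxOdd.

(** * The bound in terms of the input size *)

Lemma size_vlist T (enc : T -> value) (s : seq T) :
  size s < value_size (vlist enc s).
Proof. elim: s => //= x s; lia. Qed.

Lemma size_nodes_enc (V : finType) (t : dtree V) :
  size (nodes t) <= value_size (enc_dtree t).
Proof. elim: t => //= l IHl r IHr; rewrite size_cat; lia. Qed.

Theorem theorem4 :
  exists (p : program) (c k : nat),
    forall (G : sgraph) (t : dtree G),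
      is_decomposition t ->
      computes_within p (enc_instance t) (enc_nat (max_odd G))
        (c * value_size (enc_instance t) ^ k * 2 ^ (3 * rank_width t)).
Proof.
(* The constant is that of [main_run]. Of the exponent 3, two factors bound the square of [#|G|.+1]
   and one bounds the number of nodes. *)
exists prog, (10 * 1000), 3 => G t [uniq_t all_t].
(* A tree has a leaf, so the graph has a vertex and the adjacency matrix a first row for the leaf
   case to read. *)
have G_gt0 : 0 < #|G|.
  by apply/card_gt0P; elim: t {uniq_t all_t} => [v|l [v _] _ _]; exists v.
have tr_t := tractable_solve uniq_t (leqnn _).
have q_gt0 : 0 < 2 ^ rank_width t by rewrite expn_gt0.
have sz_rows : size (rows G) = #|G| by rewrite size_map -cardE.
have sz_row : all_size #|G| (rows G).
  by move=> x /mapP[v _ ->]; rewrite size_vec.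
have [maskE cor_t] := solve_correct uniq_t.
have leavesT : [set v in leaves t] = [set: G].
  by apply/setP => v; rewrite !inE all_t.
rewrite leavesT in cor_t.
have look : lookup (solve (rows G) t).2
    (lxor (solve (rows G) t).1 (solve (rows G) t).1) =
    Cons Nil (enc_nat (max_odd G)).
  rewrite maskE lxor_vec -[RHS]/(enc_nat (max_odd G).+1).
  rewrite -(correct_table_max_odd cor_t); congr lookup.
  by apply: eq_vec => v; rewrite addbb.
have [time run_p le_time] := main_run G_gt0 q_gt0 sz_rows sz_row tr_t look.
rewrite -enc_graph_bits in run_p; exists time => //; apply: leq_trans le_time _.
rewrite [3 * _]mulnC expnM.
have lt_n := size_vlist bits (rows G); rewrite sz_rows in lt_n.
have le_N : #|G|.+1 <= value_size (enc_instance t).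
  rewrite /enc_instance enc_graph_bits.
  exact: leq_trans lt_n (leqW (leq_addr _ _)).
have le_t : size (nodes t) <= value_size (enc_instance t).
  exact: leq_trans (size_nodes_enc t) (leqW (leq_addl _ _)).
apply: (@leq_trans (10 * (1000 *
  (value_size (enc_instance t) ^ 2 * (2 ^ rank_width t) ^ 3)) *
  value_size (enc_instance t))); last first.
  move: ((2 ^ _) ^ 3) (value_size _) => q N; rewrite (expnSr N 2).
  by move: (N ^ 2) => M; rewrite -!mulnA [N * q]mulnC.
apply: leq_mul le_t; rewrite leq_mul2l /= leq_mul2l /= leq_mul2r.
by rewrite leq_exp2r // le_N orbT.
Qed.
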